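(* There is an absolute constant $C_3>0$ such that, for every Parry number $\beta$ with ${\rm H}(n_\beta^* )=1$ and $|N(\beta)|=1$, $$\frac{{\rm rp}(n_\beta^* )}{d_P}\leq C_3\,\frac{1}{\sqrt{d_P}}.$$
   Context: For non-integer $\beta>1$, $d_\beta(1)=0.t_1t_2\ldots$ with $t_1=\lfloor\beta\rfloor$, $t_{j+1}=\lfloor\beta T_\beta^j(1)\rfloor$, $T_\beta(x)=\beta x-\lfloor\beta x\rfloor$; $\beta$ is a Parry number if $(t_i)$ is eventually periodic. Parry polynomial: if $t_i=0$ for $i>m$, $t_m\neq0$: $n_\beta^*(X)=X^m-\sum_{i=1}^mt_iX^{m-i}$; otherwise with minimal preperiod $m\ge0$ and period $p+1$: if $m\ge1$, $n_\beta^*(X)=X^{m+p+1}-\sum_{i=1}^{m+p+1}t_iX^{m+p+1-i}-X^m+\sum_{i=1}^mt_iX^{m-i}$; if $m=0$, $n_\beta^*(X)=X^{p+1}-\sum_{i=1}^pt_iX^{p+1-i}-(1+t_{p+1})$; $d_P$ is its degree. ${\rm H}$ is the height (maximum modulus of coefficients), $N(\beta)$ the algebraic norm of $\beta$, and ${\rm rp}(R)$ the number of real positive roots of $R$ counted with multiplicities. *)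

(* Defs.v *)
From HB Require Import structures.
From mathcomp Require Import all_boot all_order all_algebra.
From mathcomp Require Import boolp classical_sets reals.
From mathcomp Require Import complex polyrcf.

Set Implicit Arguments.
Unset Strict Implicit.
Unset Printing Implicit Defensive.

Import Order.TTheory GRing.Theory Num.Theory.
Local Open Scope ring_scope.

Definition beta_T {R : realType} (beta x : R) : R :=
  beta * x - (Num.floor (beta * x))%:~R.

(* The digit t_i of d_beta(1) is only meaningful for i >= 1. *)
Definition parry_digit {R : realType} (beta : R) (i : nat) : int :=
  Num.floor (beta * iter i.-1 (beta_T beta) 1).

(* The digits t_i with i > m repeat with period p + 1. *)
Definition eventually_periodic_at (t : nat -> int) (m p : nat) : Prop :=
  forall i, (m < i)%N -> t (i + p.+1)%N = t i.

Definition parry_number {R : realType} (beta : R) : Prop :=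
  [/\ 1 < beta, beta \isn't a Num.int
    & exists m p, eventually_periodic_at (parry_digit beta) m p].

Definition zero_after (t : nat -> int) (m : nat) : Prop :=
  forall i, (m < i)%N -> t i = 0.

Definition minimal_period (t : nat -> int) (m p : nat) : Prop :=
  eventually_periodic_at t m p /\
  forall m' p', eventually_periodic_at t m' p' -> (m <= m')%N /\ (p <= p')%N.

Variant parry_poly_spec (t : nat -> int) : {poly int} -> Prop :=
| ParrySimple m of (0 < m)%N & t m <> 0 & zero_after t m :
    parry_poly_spec t ('X^m - \sum_(1 <= i < m.+1) (t i)%:P * 'X^(m - i))
| ParryNonSimple m p of
    ~ (exists k, zero_after t k) & minimal_period t m p & (0 < m)%N :
    parry_poly_spec t
      ('X^(m + p.+1)
       - \sum_(1 <= i < (m + p.+1).+1) (t i)%:P * 'X^(m + p.+1 - i)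
       - 'X^m + \sum_(1 <= i < m.+1) (t i)%:P * 'X^(m - i))
| ParryPurelyPeriodic p of
    ~ (exists k, zero_after t k) & minimal_period t 0 p :
    parry_poly_spec t
      ('X^(p.+1) - \sum_(1 <= i < p.+1) (t i)%:P * 'X^(p.+1 - i)
       - (1 + t p.+1)%:P).

(* For a Parry number, exactly one polynomial satisfies the specification. *)
Definition parry_poly {R : realType} (beta : R) : {poly int} :=
  xget 0 [set P | parry_poly_spec (parry_digit beta) P].

Definition poly_degree (P : {poly int}) : nat := (size P).-1.

Definition height (P : {poly int}) : nat := (\max_(i < size P) absz (P`_i)%R)%N.

(* The minimal polynomial over the rationals when x is algebraic, else 0. *)
Definition minpolyQ {R : realType} (x : R) : {poly rat} :=
  xget 0 [set p | [/\ p \is monic, irreducible_poly p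
                    & root (map_poly ratr p) x]].

Definition complex_roots {R : realType} (p : {poly R[i]}) : seq R[i] :=
  sval (closed_field_poly_normal p).

Definition alg_norm {R : realType} (x : R) : R[i] :=
  \prod_(z <- complex_roots (map_poly ratr (minpolyQ x))) z.

Definition rp (R : realType) (P : {poly int}) : nat :=
  let PR : {poly R} := map_poly intr P in
  (\sum_(x <- rootsR PR | (0 < x)%R) mup x PR)%N.

(* Main.v *)
(* Only the height of P = sum_i a_i X^i (of degree n) matters: any integer
   polynomial with coefficients in {-1, 0, 1} has O(sqrt n) positive roots, as
   Borwein, Erdelyi and Kos proved.

   Dividing P by a power of X, assume |a_0| = 1. With N ~ sqrt n and h = 1/N put
     A = z (1 + z) / 2   and   B = 1 - (h^2 / 2) / (1 - (1 - h) z).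
   On the unit circle |B| <= 1 and |A| <= 1 - |1 - z|^2 / 8, so that
   F = sum_i a_i A^i B^(n - i) satisfies |(1 - z)^2 F(z)| <= 8 there, while
   |F(0)| = B(0)^n >= 1/2. Each root r of P in (0, 1] gives a root s of A - r B,
   hence of F, with 0 <= s <= 1 - h/6: near 1 the value of B has dropped by
   about h, which lets A/B reach 1 before z does. Dividing out the k Blaschke
   factors of these roots, the maximum principle gives 1/2 <= 8 (1 - h/6)^k up
   to a constant factor, so k = O(1/h) = O(sqrt n). The roots in [1, +oo) are
   handled in the same way, exchanging A and B. *)
Require Import Defs.
From mathcomp Require Import all_boot all_order all_algebra.
From mathcomp Require Import reals complex.
From mathcomp Require Import polyrcf ring lra zify.

Import Order.TTheory GRing.Theory Num.Theory.
Import ComplexField.Normc.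
Local Open Scope ring_scope.

(** * Modulus of complex numbers *)

Lemma normc_ge0 (R : rcfType) (z : R[i]) : 0 <= normc z.
Proof. by case: z => x y; apply: sqrtr_ge0. Qed.

Lemma sqr_normcE (R : rcfType) (z : R[i]) :
  normc z ^+ 2 = complex.Re z ^+ 2 + complex.Im z ^+ 2.
Proof. by case: z => x y /=; rewrite sqr_sqrtr // addr_ge0 ?sqr_ge0. Qed.

Lemma normcX (R : rcfType) (z : R[i]) n : normc (z ^+ n) = normc z ^+ n.
Proof. by elim: n => [|n IH]; rewrite ?expr0 ?normc1 // !exprS normcM IH. Qed.

Lemma normc_real (R : rcfType) (x : R) : normc x%:C%C = `|x|.
Proof. by rewrite /= expr0n addr0 sqrtr_sqr. Qed.

Lemma le_normc_sum (R : rcfType) n (F : 'I_n -> R[i]) :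
  normc (\sum_i F i) <= \sum_i normc (F i).
Proof.
elim/big_ind2: _ => [|a x b y ax by_|//]; first by rewrite normc0.
by rewrite (le_trans (le_normcD x y)) ?lerD.
Qed.

(** * Maximum principle at the origin *)

(* Averaging over z and -z replaces p by its even part, which takes the values
   (p(z) + p(-z)) / 2 at z^2: this halves the degree and keeps both the bound
   on the circle and the value at 0. *)
Lemma max_modulus0 (R : rcfType) (p : {poly R[i]}) (M : R) :
  (forall z, normc z = 1 -> normc p.[z] <= M) -> normc p.[0] <= M.
Proof.
have [n] := ubnP (size p); elim: n p => // n IH p szp hp.
have [sz1|sz1] := leqP (size p) 1.
  have := hp 1 (normc1 R); have := size1_polyC sz1.
  by move: (p`_0) => c ->; rewrite !hornerC.
have -> : p.[0] = (even_poly p).[0] by rewrite !horner_coef0 coef_even_poly.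
apply: IH => [|w w1].
  by apply: (leq_ltn_trans (size_even_poly p)); rewrite uphalf_half; lia.
have [z zw] : exists z : R[i], z ^+ 2 = w by exists (sqrtC w); rewrite sqrtCK.
have z1 : normc z = 1.
  apply/eqP; rewrite -(@eqrXn2 _ 2) ?normc_ge0 ?ler01 // expr1n -normcX zw.
  exact/eqP.
have evE : (even_poly p).[w] = (p.[z] + p.[- z]) / 2%:R.
  rewrite -{2 3}(poly_even_odd p) !hornerD !hornerM !horner_comp.
  rewrite !hornerXn !hornerX sqrrN zw.
  by field.
have half1 : normc (2%:R^-1 : R[i]) = 2^-1.
  have -> : (2%:R^-1 : R[i]) = (2^-1 : R)%:C%C by rewrite fmorphV rmorph_nat.
  by rewrite normc_real ger0_norm // invr_ge0.
rewrite evE normcM half1.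
have := hp _ z1; have := hp (- z); rewrite normcN => /(_ z1).
by have := le_normcD p.[z] p.[- z]; lra.
Qed.

Lemma bernoulli_ge (R : realDomainType) (x : R) n :
  -1 <= x -> 1 + n%:R * x <= (1 + x) ^+ n.
Proof.
move=> x1; elim: n => [|n IH]; first by rewrite mul0r addr0 expr0.
rewrite exprS (le_trans _ (ler_wpM2l _ IH)) //; last lra.
by rewrite -natr1; have := ler0n R n; nra.
Qed.

(* The powers of 1/(1 - qX) are replaced by powers of the truncated geometric
   series, long enough to cost only a factor 2. *)
Lemma max_modulus0_div (R : rcfType) (p : {poly R[i]}) (M : R) (N n : nat) :
  (0 < N)%N ->
  (forall z, normc z = 1 ->
     normc p.[z] <= M * normc (1 - (1 - N%:R^-1)%:C%C * z) ^+ n) ->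
  normc p.[0] <= 2 * M.
Proof.
move=> N0 hp; set q : R := 1 - N%:R^-1.
have Nr : 1 <= N%:R :> R by rewrite ler1n.
have h0 : 0 < N%:R^-1 :> R by rewrite invr_gt0; lra.
have h1 : N%:R^-1 <= 1 :> R by rewrite invf_le1 //; lra.
have q0 : 0 <= q by rewrite /q; lra.
pose L := (2 * n * N).+1; pose t := q ^+ L.
have t0 : 0 <= t by exact: exprn_ge0.
(* With h = 1/N, (1 + h)(1 - h) <= 1 bounds t by (1 + h)^(-L), and Bernoulli gives (1 + h)^L >= 2n
   for this [L]. *)
have tn : 2 * n%:R * t <= 1.
  have le1 : (1 + N%:R^-1) ^+ L * t <= 1.
    rewrite /t -exprMn exprn_ile1 // ?mulr_ge0 //; [lra|rewrite /q; nra].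
  apply: le_trans le1; rewrite ler_wpM2r //.
  apply: le_trans (@bernoulli_ge _ _ L _); last lra.
  have -> : L%:R = 2 * n%:R * N%:R + 1 :> R by rewrite -!natrM natr1.
  have -> : (2 * n%:R * N%:R + 1) / N%:R = 2 * n%:R + N%:R^-1 :> R.
    by field; rewrite gt_eqF //; lra.
  lra.
have t12 : (1 + t) ^+ n <= 2.
  have le1 : (1 + t) ^+ n * (1 - t) ^+ n <= 1.
    case: (n) tn => [|m] tm; first by rewrite !expr0 mulr1.
    have : 1 <= m.+1%:R :> R by rewrite ler1n.
    by move=> m1; rewrite -exprMn exprn_ile1 //; nra.
  have le2 : 1 / 2 <= (1 - t) ^+ n.
    case: (n) tn => [|m] tm; first by rewrite expr0; lra.
    have m1 : 1 <= m.+1%:R :> R by rewrite ler1n.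
    by apply: le_trans (@bernoulli_ge _ _ _ _); nra.
  by have : 0 <= (1 + t) ^+ n by [apply: exprn_ge0; lra]; nra.
(* At z = 1 the factor of [M] is a power of h > 0. *)
have M0 : 0 <= M.
  have := le_trans (normc_ge0 _ _) (hp 1 (normc1 R)).
  rewrite mulr1 -[1]/(1%:C%C) -rmorphB normc_real pmulr_lge0 //.
  by rewrite exprn_gt0 // normr_gt0 /q opprB addrC subrK gt_eqF.
pose S : {poly R[i]} := \sum_(i < L) (q%:C%C *: 'X) ^+ i.
have S0 : S.[0] = 1.
  rewrite /S horner_sum big_ord_recl expr0 hornerC big1 ?addr0 // => i _.
  by rewrite horner_exp hornerZ hornerX mulr0 expr0n.
have SE z : S.[z] * (1 - q%:C%C * z) = 1 - (q%:C%C * z) ^+ L.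
  have /(congr1 (horner^~ z)) := subrX1 (q%:C%C *: 'X : {poly R[i]}) L.
  rewrite -/S hornerM !hornerD hornerN horner_exp hornerZ hornerX hornerC => e.
  by rewrite -[RHS]opprB e; ring.
have -> : p.[0] = (p * S ^+ n).[0].
  by rewrite hornerM horner_exp S0 expr1n mulr1.
have : normc (p * S ^+ n).[0] <= M * (1 + t) ^+ n.
  apply: max_modulus0 => z z1; rewrite hornerM horner_exp normcM normcX.
  apply: le_trans (ler_wpM2r _ (hp z z1)) _.
    by rewrite exprn_ge0 ?normc_ge0.
  rewrite -mulrA -exprMn ler_wpM2l //.
  rewrite lerXn2r ?nnegrE ?mulr_ge0 ?normc_ge0 ?addr_ge0 //.
  rewrite mulrC -normcM SE; apply: le_trans (le_normcD _ _) _.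
  rewrite normc1 normcN normcX normcM z1 mulr1 normc_real ger0_norm //.
move/le_trans; apply; nra.
Qed.

(** * Homogenization *)

(** This is V^n f(U/V) cleared of denominators, for f of degree at most n. *)
Definition hom_poly {R : comNzRingType} (n : nat) (f U V : {poly R}) :
    {poly R} :=
  \sum_(i < n.+1) f`_i *: (U ^+ i * V ^+ (n - i)).

Lemma hom_polyM_XsubC (R : comNzRingType) n (r : R) (f U V : {poly R}) :
  (size f <= n.+1)%N ->
  hom_poly n.+1 (('X - r%:P) * f) U V = (U - r *: V) * hom_poly n f U V.
Proof.
move=> szf; rewrite /hom_poly [RHS]mulrBl mulr_sumr.
have -> : \sum_(i < n.+2) (('X - r%:P) * f)`_i *: (U ^+ i * V ^+ (n.+1 - i)) =
    \sum_(i < n.+2) ('X * f)`_i *: (U ^+ i * V ^+ (n.+1 - i)) -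
    \sum_(i < n.+2) (r * f`_i) *: (U ^+ i * V ^+ (n.+1 - i)).
  rewrite -sumrB; apply: eq_bigr => i _.
  by rewrite mulrBl coefB coefCM scalerBl.
congr (_ - _).
  rewrite big_ord_recl coefXM scale0r add0r; apply: eq_bigr => i _.
  by rewrite coefXM /= subSS exprS -mulrA scalerAr.
rewrite big_ord_recr /= nth_default // mulr0 scale0r addr0 mulr_sumr.
apply: eq_bigr => i _; rewrite subSn ?leq_ord // exprS.
by rewrite -!scalerAl -!scalerAr !scalerA mulrCA.
Qed.

Lemma hom_poly_dvd (F : fieldType) n (rs : seq F) (f U V : {poly F}) :
  (size f <= n.+1)%N -> \prod_(r <- rs) ('X - r%:P) %| f ->
  \prod_(r <- rs) (U - r *: V) %| hom_poly n f U V.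
Proof.
(* For nonzero f, each linear factor removed lowers the degree, so n can drop with it in the
   induction. *)
have [->|f0] := eqVneq f 0.
  move=> _ _; rewrite /hom_poly [X in _ %| X]big1 ?dvdp0 // => i _.
  by rewrite coef0 scale0r.
elim: rs n f f0 => [|r rs IH] n f f0.
  by move=> _ _; rewrite !big_nil dvd1p.
rewrite !big_cons => szf /dvdpP [g fE].
have hE : f = ('X - r%:P) * (g * \prod_(r <- rs) ('X - r%:P)).
  by rewrite fE mulrCA.
move: hE szf f0; set h := g * _ => -> szf; rewrite mulf_eq0 negb_or.
case/andP=> _ h0; move: szf.
rewrite size_monicM ?monicXsubC // size_XsubC /= ltnS.
case: n => [|n] szh; first by move: h0; rewrite -size_poly_gt0 ltnNge szh.
by rewrite hom_polyM_XsubC // dvdp_mul // IH // dvdp_mulIr.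
Qed.

(** * Root count in the warped disk *)

Section WarpedDisk.
Variables (R : rcfType) (N : nat).
Hypothesis N_gt0 : (0 < N)%N.

Local Notation h := (N%:R^-1 : R).

(* In the notation of the header, warp_num = A * warp_den and
   warp_out = B * warp_den: the denominator of B is cleared. *)
Definition warp_den : {poly R} := 1 - (1 - h) *: 'X.
Definition warp_num : {poly R} := 2^-1 *: ('X * (1 + 'X) * warp_den).
Definition warp_out : {poly R} := warp_den - (h ^+ 2 / 2)%:P.

Let h_gt0 : 0 < h. Proof. by rewrite invr_gt0 ltr0n. Qed.
Let h_le1 : h <= 1. Proof. by rewrite invf_le1 ?ltr0n // ler1n. Qed.

Lemma horner_warp_den x : warp_den.[x] = 1 - (1 - h) * x.
Proof. by rewrite /warp_den hornerD hornerN hornerZ hornerX hornerC. Qed.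

Lemma horner_warp_num x : warp_num.[x] = x * (1 + x) * (1 - (1 - h) * x) / 2.
Proof.
rewrite /warp_num hornerZ !hornerM horner_warp_den hornerD hornerX hornerC.
by rewrite mulrC.
Qed.

Lemma horner_warp_out x : warp_out.[x] = 1 - (1 - h) * x - h ^+ 2 / 2.
Proof. by rewrite /warp_out hornerD hornerN hornerC horner_warp_den. Qed.

(** Intermediate values: at 0 [warp_num] vanishes and [warp_out] is positive. At b = 1 - h/6 the
    denominator is at most 7h/6, so B loses at least 3h/7 there, whereas A >= 1 - h/4; hence A >= B
    >= r B if B >= 0. *)
Lemma warp_root (r : R) : 0 <= r <= 1 ->
  exists2 s, 0 <= s <= 1 - h / 6 & root (warp_num - r *: warp_out) s.
Proof.
have h0 := h_gt0; have h1 := h_le1.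
move=> /andP[r0 r1]; have hh : 0 <= h * (1 - h) by rewrite mulr_ge0 //; lra.
pose b := 1 - h / 6.
have b0 : 0 <= b by rewrite /b; lra.
apply: (Num.Theory.poly_ivt b0).
rewrite 2!hornerD 2!hornerN 2!(hornerZ r) !horner_warp_num !horner_warp_out.
apply/andP; split.
  have : 0 <= r * (1 - h ^+ 2 / 2) by rewrite mulr_ge0 //; nra.
  lra.
have d0 : 0 <= 1 - (1 - h) * b by rewrite /b; nra.
have num0 : 0 <= b * (1 + b) * (1 - (1 - h) * b) / 2.
  have b2 : 0 <= b * (1 + b) by rewrite mulr_ge0 //; lra.
  by have := mulr_ge0 b2 d0; lra.
have num_out :
    1 - (1 - h) * b - h ^+ 2 / 2 <= b * (1 + b) * (1 - (1 - h) * b) / 2.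
  have e1 : b * (1 + b) / 2 >= 1 - h / 4 by rewrite /b; nra.
  have e2 : 1 - (1 - h) * b <= 7 * h / 6 by rewrite /b; nra.
  nra.
nra.
Qed.

Local Notation toC p := (map_poly (real_complex R) p).

Lemma horner_toC_warp_den (z : R[i]) :
  (toC warp_den).[z] = 1 - (1 - h)%:C%C * z.
Proof.
rewrite [toC _]rmorphB rmorph1 /= map_polyZ map_polyX.
by rewrite hornerD hornerN hornerZ hornerX hornerC.
Qed.

(** Since Re [warp_den] >= h on the circle, subtracting h^2/2 cannot increase the modulus. For A, |1
    + z|^2 = 4 - t <= (2 - t/4)^2. *)
Lemma warp_circle (z : R[i]) (d := normc (toC warp_den).[z])
    (t := normc (1 - z) ^+ 2) : normc z = 1 ->
  [/\ t <= 4, normc (toC warp_out).[z] <= d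
    & normc (toC warp_num).[z] <= (1 - t / 8) * d].
Proof.
have h0 := h_gt0; have h1 := h_le1.
move=> z1; have := sqr_normcE _ z; rewrite z1 expr1n => xy1.
have tE : t = 2 - 2 * complex.Re z.
  by rewrite /t sqr_normcE; case: (z) xy1 => x y /= xy1; lra.
have [x1 x2] : -1 <= complex.Re z /\ complex.Re z <= 1 by split; nra.
split; first by rewrite tE; lra.
  rewrite -(@ler_pXn2r _ 2) ?nnegrE ?normc_ge0 // !sqr_normcE.
  rewrite [toC warp_out]rmorphB /= map_polyC hornerD hornerN hornerC.
  rewrite horner_toC_warp_den; case: (z) xy1 x1 x2 => x y /= xy1 x1 x2.
  have hx : h <= 1 - (1 - h) * x by nra.
  have : 0 <= h ^+ 2 / 2 * (2 * (1 - (1 - h) * x) - h ^+ 2 / 2).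
    by rewrite mulr_ge0 //; nra.
  rewrite !(mul0r, subr0, add0r, oppr0, addr0).
  nra.
have -> : (toC warp_num).[z] = 2^-1%:C%C * (z * (1 + z) * (toC warp_den).[z]).
  rewrite [toC warp_num]map_polyZ hornerZ !rmorphM /= !hornerM.
  by rewrite [toC (1 + 'X)]rmorphD rmorph1 /= map_polyX hornerD hornerX hornerC.
rewrite !normcM z1 mul1r normc_real ger0_norm ?invr_ge0 // mulrA.
apply: ler_wpM2r; first exact: normc_ge0.
have : normc (1 + z) <= 2 - t / 4.
  rewrite -(@ler_pXn2r _ 2) ?nnegrE ?normc_ge0 //; last by rewrite tE; lra.
  rewrite sqr_normcE tE; case: (z) xy1 => x y /= xy1; nra.
lra.
Qed.

Variables (n : nat) (c : nat -> R) (ss : seq R).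
Hypothesis n_le : (n <= N ^ 2)%N.
Hypotheses (c0 : `|c 0| = 1) (c_le1 : forall i, `|c i| <= 1).
(** The coefficients are a sequence [c] so that [F] serves both for f and for f with its
    coefficients reversed. *)
Let F : {poly R} :=
  \sum_(i < n.+1) c i *: (warp_num ^+ i * warp_out ^+ (n - i)).

(** The terms are dominated by a geometric series of ratio a = 1 - t/8. Multiplying by t = 8(1 - a)
    telescopes it and covers z = 1, where t = 0. *)
Lemma warp_circle_bound (z : R[i]) : normc z = 1 ->
  normc (toC F).[z] * normc (1 - z) ^+ 2 <= 8 * normc (toC warp_den).[z] ^+ n.
Proof.
move=> z1; have := warp_circle z z1; set d := normc (toC warp_den).[z].
set t := normc (1 - z) ^+ 2 => -[t4 outd].
set a := 1 - t / 8 => numd.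
have t0 : 0 <= t by rewrite exprn_ge0 ?normc_ge0.
have d0 : 0 <= d := normc_ge0 _ _.
have a0 : 0 <= a by rewrite /a; lra.
have FE : (toC F).[z] = \sum_(i < n.+1)
    (c i)%:C%C * ((toC warp_num).[z] ^+ i * (toC warp_out).[z] ^+ (n - i)).
  rewrite /F; move: warp_num warp_out => U V.
  rewrite rmorph_sum horner_sum; apply: eq_bigr => i _.
  by rewrite /= map_polyZ hornerZ rmorphM /= hornerM !rmorphXn /= !horner_exp.
have leF : normc (toC F).[z] <= d ^+ n * \sum_(i < n.+1) a ^+ i.
  rewrite FE (le_trans (le_normc_sum _ _ _)) // mulr_sumr ler_sum // => i _.
  rewrite !normcM !normcX normc_real -[leRHS]mul1r ler_pM //.
  - by rewrite mulr_ge0 // exprn_ge0 ?normc_ge0.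
  - have -> : d ^+ n * a ^+ i = (a * d) ^+ i * d ^+ (n - i).
      by rewrite exprMn -mulrA -exprD subnKC ?leq_ord // mulrC.
    by rewrite ler_pM ?exprn_ge0 ?normc_ge0 //
       lerXn2r ?nnegrE ?normc_ge0 ?mulr_ge0.
have geo : t * \sum_(i < n.+1) a ^+ i <= 8.
  have -> : t = 8 * (1 - a) by rewrite /a; lra.
  by have := subrX1 a n.+1; have := exprn_ge0 n.+1 a0; lra.
apply: le_trans (ler_wpM2r t0 leF) _.
by have := ler_wpM2l (exprn_ge0 n d0) geo; lra.
Qed.

Lemma warp_root_count : \prod_(s <- ss) ('X - s%:P) %| F ->
  (forall s, s \in ss -> 0 <= s <= 1 - h / 6) ->
  (size ss <= 186 * N)%N.
Proof.
have h0 := h_gt0; have h1 := h_le1; move=> /dvdpP [H FE] ssP.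
(* Blaschke division in polynomial form: replacing X - s by 1 - sX keeps the modulus on the circle
   and makes the value at 0 equal to 1. *)
pose G := \prod_(s <- ss) (1 - s *: 'X) * (H * (1 - 'X) ^+ 2).
have prodE z : normc z = 1 ->
    normc (toC (\prod_(s <- ss) (1 - s *: 'X))).[z] =
    normc (toC (\prod_(s <- ss) ('X - s%:P))).[z].
  move=> z1; rewrite !rmorph_prod !horner_prod.
  elim: (ss) => [|s r IH]; rewrite ?big_nil // !big_cons !normcM IH.
  congr (_ * _); rewrite !rmorphB rmorph1 /= map_polyZ !map_polyX map_polyC.
  rewrite !hornerD !hornerN hornerZ hornerX !hornerC.
  apply/eqP; rewrite -(@eqrXn2 _ 2) ?normc_ge0 // !sqr_normcE.
  have := sqr_normcE _ z; rewrite z1 expr1n; case: (z) => x y /= xy1.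
  apply/eqP; move: xy1; nra.
have G0 : normc (toC G).[0] <= 2 * 8.
  apply: (@max_modulus0_div _ _ _ _ n N_gt0) => z z1.
  rewrite -horner_toC_warp_den; apply: le_trans (warp_circle_bound z z1).
  have sqE : (toC ((1 - 'X) ^+ 2)).[z] = (1 - z) ^+ 2.
    by rewrite rmorphXn horner_exp rmorphB rmorph1 /= map_polyX !hornerE.
  rewrite FE /G rmorphM hornerM rmorphM hornerM [in leRHS]rmorphM hornerM sqE.
  by rewrite normcM !(normcM (toC H).[z]) normcX prodE // mulrCA mulrA.
have G0E : normc (toC G).[0] = `|H.[0]|.
  rewrite -[0]/(0%:C%C) horner_map normc_real /G !hornerM horner_prod big1.
    by rewrite mul1r hornerD hornerN hornerX hornerC subr0 !mulr1.
  by move=> s _; rewrite hornerD hornerN hornerZ hornerX hornerC mulr0 subr0.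
have F0 : F.[0] = c 0%N * (1 - h ^+ 2 / 2) ^+ n.
  rewrite /F horner_sum big_ord_recl big1 => [|i _].
    rewrite addr0 subn0 expr0 mul1r.
    by rewrite hornerZ horner_exp horner_warp_out mulr0 subr0.
  rewrite hornerZ hornerM !horner_exp horner_warp_num.
  by rewrite !mul0r expr0n mul0r mulr0.
have F0ge : 2^-1 <= `|F.[0]|.
  rewrite F0 normrM c0 mul1r ger0_norm; last by rewrite exprn_ge0; nra.
  apply: le_trans (bernoulli_ge R (- (h ^+ 2 / 2)) n _); last nra.
  have : n%:R * h ^+ 2 <= 1.
    rewrite exprVn ler_pdivrMr ?mul1r -?natrX ?ler_nat //.
    by rewrite ltr0n expn_gt0 N_gt0.
  lra.
have prod0 : `|(\prod_(s <- ss) ('X - s%:P)).[0]| <= (1 - h / 6) ^+ size ss.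
  rewrite horner_prod; elim: ss ssP => [|s r IH] rP.
    by rewrite big_nil normr1.
  rewrite big_cons normrM exprS ler_pM ?IH //.
  + have /andP[s0 s1] := rP s (mem_head _ _).
    by rewrite hornerXsubC sub0r normrN ger0_norm.
  + by move=> u ur; rewrite rP // inE ur orbT.
(* From 1/2 <= |F(0)| <= 16 (1 - h/6)^k, multiplied by (1 + h/6)^k. Bernoulli then gives k h/6 <=
   31, and 186 = 6 * 31. *)
have kb : (1 + h / 6) ^+ size ss <= 32.
  have pm : (1 + h / 6) ^+ size ss * (1 - h / 6) ^+ size ss <= 1.
    by rewrite -exprMn exprn_ile1 //; nra.
  have p0 : 0 <= (1 + h / 6) ^+ size ss by rewrite exprn_ge0; nra.
  have : 2^-1 <= 2 * 8 * (1 - h / 6) ^+ size ss.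
    rewrite (le_trans F0ge) // FE hornerM normrM ler_pM //.
    by rewrite -G0E.
  by move/(ler_wpM2l p0); lra.
have : 1 + (size ss)%:R * (h / 6) <= 32.
  by apply: le_trans kb; apply: bernoulli_ge; lra.
rewrite -(ler_nat R) natrM -ler_pdivrMr ?ltr0n //; lra.
Qed.

End WarpedDisk.

(** * Roots of polynomials with coefficients bounded by one *)

(** One root is chosen per factor, so a repeated r still contributes with its multiplicity even when
    the chosen roots coincide. *)
Lemma roots_dvd_prod (F : fieldType) (P : pred F) (g : F -> {poly F})
    (rs : seq F) :
  (forall r, r \in rs -> exists2 s, P s & root (g r) s) ->
  exists ss : seq F, [/\ size ss = size rs, (forall s, s \in ss -> P s)
    & \prod_(s <- ss) ('X - s%:P) %| \prod_(r <- rs) g r].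
Proof.
elim: rs => [|r rs IH] hg; first by exists [::]; rewrite !big_nil dvdpp.
have [s Ps rt] := hg r (mem_head _ _).
have [|ss [sz ssP dv]] := IH.
  by move=> u ur; apply: hg; rewrite inE ur orbT.
exists (s :: ss); split; first by rewrite /= sz.
  by move=> u; rewrite inE => /predU1P[->|/ssP].
by rewrite !big_cons dvdp_mul // dvdp_XsubCl.
Qed.

Section RootsOfBoundedPolynomial.
Variables (R : rcfType) (N n : nat) (f : {poly R}) (rs : seq R).
Hypotheses (N_gt0 : (0 < N)%N) (n_le : (n <= N ^ 2)%N).
Hypotheses (szf : (size f <= n.+1)%N) (f_le1 : forall i, `|f`_i| <= 1).
Hypothesis rs_dvd : \prod_(r <- rs) ('X - r%:P) %| f.

Lemma count_roots_le1 : `|f`_0| = 1 ->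
  (forall r, r \in rs -> 0 <= r <= 1) -> (size rs <= 186 * N)%N.
Proof.
move=> f0 rsP.
have [ss [<- ssP ssd]] := roots_dvd_prod R
  (fun s => 0 <= s <= 1 - N%:R^-1 / 6)
  (fun r => warp_num R N - r *: warp_out R N)
  rs (fun r hr => warp_root R N N_gt0 r (rsP r hr)).
apply: (warp_root_count R N N_gt0 n (fun i => f`_i) ss n_le f0 f_le1 _ ssP).
exact: dvdp_trans ssd (hom_poly_dvd _ _ _ _ _ _ szf rs_dvd).
Qed.

(* With the two arguments of the homogenization swapped, the roots of f are
   replaced by their inverses. *)
Lemma count_roots_ge1 : `|f`_n| = 1 ->
  (forall r, r \in rs -> 1 <= r) -> (size rs <= 186 * N)%N.
Proof.
move=> fn rsP.
have rt r : r \in rs -> exists2 s, 0 <= s <= 1 - N%:R^-1 / 6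
    & root (warp_out R N - r *: warp_num R N) s.
  move/rsP => r1; have r0 : 0 < r by lra.
  have [|s sP rs0] := @warp_root R N N_gt0 r^-1.
    by rewrite invr_ge0 ltW //= invf_le1.
  exists s => //; have -> : warp_out R N - r *: warp_num R N =
      - (r *: (warp_num R N - r^-1 *: warp_out R N)).
    move: (warp_num R N) (warp_out R N) => U V.
    by rewrite scalerBr scalerA mulfV ?gt_eqF // scale1r opprB.
  by rewrite rootN rootZ ?gt_eqF.
have [ss [<- ssP ssd]] := roots_dvd_prod R
  (fun s => 0 <= s <= 1 - N%:R^-1 / 6) _ rs rt.
apply: (warp_root_count R N N_gt0 n (fun i => f`_(n - i)) ss n_le _ _ _ ssP)
  => //.
  by rewrite subn0.
apply: dvdp_trans ssd _.
have := hom_poly_dvd _ n _ _ (warp_out R N) (warp_num R N) szf rs_dvd.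
rewrite /hom_poly (reindex_inj rev_ord_inj) /=.
congr (_ %| _); apply: eq_bigr => i _.
by rewrite subSS subKn ?leq_ord // mulrC.
Qed.

End RootsOfBoundedPolynomial.

(** * Multiplicities and polynomials of height one *)

(** Powers of distinct linear factors are pairwise coprime. *)
Lemma prod_mup_dvd (F : fieldType) (f : {poly F}) (s : seq F) :
  f != 0 -> uniq s -> \prod_(x <- s) ('X - x%:P) ^+ mup x f %| f.
Proof.
move=> f0; elim: s => [|x s IH] /=; first by rewrite big_nil dvd1p.
case/andP=> xs us; rewrite big_cons Gauss_dvdp.
  by rewrite IH // -mup_geq ?leqnn.
apply: coprimep_expl; rewrite coprimep_sym coprimep_XsubC.
rewrite /root horner_prod prodf_seq_neq0; apply/allP => y ys /=.
rewrite horner_exp hornerXsubC expf_neq0 // subr_eq0.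
by apply: contraNneq xs => ->.
Qed.

(** Turns a sum of multiplicities into the length of a list with repetitions, the form the root
    counts take. *)
Lemma mup_root_seq (F : fieldType) (f : {poly F}) (s : seq F) :
  f != 0 -> uniq s ->
  exists rs : seq F, [/\ size rs = (\sum_(x <- s) mup x f)%N,
    {subset rs <= s} & \prod_(r <- rs) ('X - r%:P) %| f].
Proof.
move=> f0 us; exists (flatten [seq nseq (mup x f) x | x <- s]); split.
- rewrite size_flatten sumnE !big_map; apply: eq_bigr => x _.
  by rewrite size_nseq.
- by move=> r /flatten_mapP[x xs]; rewrite mem_nseq => /andP[_ /eqP->].
- apply: dvdp_trans (prod_mup_dvd _ _ _ f0 us).
  rewrite big_flatten big_map.
  under eq_bigr => x _ do rewrite big_nseq -Monoid.iteropE.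
  exact: dvdpp.
Qed.

Lemma absz_coef_le_height (P : {poly int}) (i : nat) :
  (absz (P`_i)%R <= height P)%N.
Proof.
have [szP|szP] := leqP (size P) i; first by rewrite nth_default.
exact: (leq_bigmax (Ordinal szP)).
Qed.

Lemma count_roots_height1 (R : rcfType) (P : {poly int}) (N : nat) (s : seq R)
    (f : {poly R} := map_poly intr P) :
  height P = 1%N -> (0 < N)%N -> (poly_degree P <= N ^ 2)%N ->
  uniq s -> (forall x, x \in s -> 0 < x) ->
  (\sum_(x <- s) mup x f <= 372 * N)%N.
Proof.
move=> hP N0 nN us s0.
have P0 : P != 0.
  by apply: contraPneq hP => ->; rewrite /height big1 // => i; rewrite coef0.
have f0 : f != 0 by rewrite map_poly_eq0_id0 // intr_eq0 lead_coef_eq0.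
have szf : size f = size P by rewrite size_map_inj_poly //; exact: intr_inj.
have coef_f i : f`_i != 0 -> `|f`_i| = 1.
  rewrite coef_map /= intr_eq0 -intr_norm => Pi0.
  have := absz_coef_le_height P i; rewrite hP => Pi1.
  suff -> : `|P`_i| = 1 by [].
  by rewrite -abszE; congr Posz; apply/eqP; rewrite eqn_leq Pi1 absz_gt0.
have f_le1 i : `|f`_i| <= 1.
  by have [->|/coef_f->] := eqVneq f`_i 0; rewrite ?normr0.
have szP : (0 < size P)%N by rewrite size_poly_gt0.
have -> : (372 * N = 186 * N + 186 * N)%N by lia.
(* Roots up to 1 use a constant term of modulus 1, the others a leading coefficient of modulus 1. *)
rewrite (bigID (fun x => x <= 1)); apply: leq_add; rewrite -big_filter.
  have [rs [<- rsP rsd]] :=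
    mup_root_seq _ _ _ f0 (filter_uniq (fun x => x <= 1) us).
  have rs01 r : r \in rs -> 0 <= r <= 1.
    by move/rsP; rewrite mem_filter => /andP[-> /s0/ltW->].
  (* Dividing by X^m makes the constant term nonzero, hence 1 or -1, and keeps the positive
     roots. *)
  have [m [g gr fE]] := multiplicity_XsubC f 0.
  rewrite f0 /= in gr; rewrite subr0 in fE.
  have gE i : g`_i = f`_(i + m) by rewrite fE coefMXn ltnNge leq_addl addnK.
  apply: (count_roots_le1 _ _ _ g _ N0 nN) => //.
  - rewrite prednK // -szf fE size_Mmonic ?monicXn //.
      by rewrite size_polyXn addnS /= leq_addr.
    by apply: contraNneq gr => ->; rewrite root0.
  - by move=> i; rewrite gE.
  - move: rsd; rewrite fE Gauss_dvdpl // coprimep_expr //.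
    rewrite -[X in coprimep _ X]subr0 coprimep_XsubC /root horner_prod.
    rewrite prodf_seq_neq0; apply/allP => r /rsP /=; rewrite mem_filter => /andP[_ /s0 r0].
    by rewrite hornerXsubC sub0r oppr_eq0 gt_eqF.
  - by rewrite gE coef_f // -gE -horner_coef0.
have [rs [<- rsP rsd]] :=
  mup_root_seq _ _ _ f0 (filter_uniq (fun x => ~~ (x <= 1)) us).
apply: (count_roots_ge1 _ _ (poly_degree P) f _ N0 nN) => //.
- by rewrite prednK // szf.
- by rewrite coef_f // /poly_degree -szf -lead_coefE lead_coef_eq0.
- by move=> r /rsP; rewrite mem_filter -ltNge => /andP[/ltW].
Qed.

(** * Passage to the square root of the degree *)

(** The least N with n <= N^2 satisfies N - 1 <= sqrt n, and 1 <= sqrt n. *)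
Lemma exists_nat_sqrt (R : rcfType) (n : nat) : (0 < n)%N ->
  exists N, [/\ (0 < N)%N, (n <= N ^ 2)%N & N%:R <= 2 * Num.sqrt n%:R :> R].
Proof.
move=> n0; have ex : exists N, (n <= N ^ 2)%N by exists n; rewrite leq_pmulr.
case: (ex_minnP ex) => [[|N]] nN minN; first by lia.
exists N.+1; split => //.
have Nn : (N ^ 2 <= n)%N.
  by have [/minN|/ltnW//] := leqP n (N ^ 2); rewrite ltnn.
have le1 : 1 <= Num.sqrt n%:R :> R.
  by rewrite -[leLHS]sqrtr1 ler_wsqrtr // ler1n.
have leN : N%:R <= Num.sqrt n%:R :> R.
  by rewrite -[leLHS]ger0_norm // -sqrtr_sqr ler_wsqrtr // -natrX ler_nat.
by rewrite -natr1; lra.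
Qed.

Theorem theorem3p22 (R : realType) :
  exists2 C3 : R, 0 < C3 &
    forall beta : R, parry_number beta ->
      height (parry_poly beta) = 1%N ->
      `|alg_norm beta| = 1 ->
      (rp R (parry_poly beta))%:R / (poly_degree (parry_poly beta))%:R
        <= C3 * (1 / Num.sqrt (poly_degree (parry_poly beta))%:R).
Proof.
(* 744 = 2 * 372: at most 372 N positive roots, with N <= 2 sqrt n. *)
exists 744 => // beta _; move: (parry_poly beta) => P hP _.
set n := poly_degree P.
(* In degree 0 both sides are 0, since the inverse of 0 is 0. *)
have [->|n0] := posnP n; first by rewrite invr0 mulr0 sqrtr0 invr0 mul1r mulr0.
have [N [N0 nN sqN]] := exists_nat_sqrt R n n0.
have sq0 : 0 < Num.sqrt n%:R :> R by rewrite sqrtr_gt0 ltr0n.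
have rpN : (rp R P <= 372 * N)%N.
  rewrite /rp -big_filter; apply: count_roots_height1 => //.
    exact/filter_uniq/uniq_roots.
  by move=> x; rewrite mem_filter => /andP[].
have : (rp R P)%:R <= 744 * Num.sqrt n%:R :> R.
  by apply: le_trans (_ : (372 * N)%:R <= _); rewrite ?ler_nat // natrM; lra.
have nE : n%:R = Num.sqrt n%:R * Num.sqrt n%:R :> R.
  by rewrite -expr2 sqr_sqrtr // ler0n.
move=> le; rewrite {1}nE invfM mulrA mul1r ler_pM2r ?invr_gt0 //.
by rewrite ler_pdivrMr.
Qed.
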